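(* For any $n$ and any $M(n)$, there exists a set $\mathcal P$ of $n$ points in $\mathbb R^2$ such that no line or circle contains $M(n)$ points of $\mathcal P$, and $\mathcal E(\mathcal P)=\Omega\left(M(n)n^2\right)$ (with an absolute implicit constant).
   Context: For distinct points $a,b\in\mathbb R^2$, $\mathrm{bis}(a,b)$ denotes their perpendicular bisector. The bisector energy of a finite set $\mathcal P\subset\mathbb R^2$ is $\mathcal E(\mathcal P)=\left|\{(a,b,c,d)\in\mathcal P^4 : a\neq b,\ c\neq d,\ \mathrm{bis}(a,b)=\mathrm{bis}(c,d)\}\right|$.
   Formalization: Proved for 4 ≤ M(n) ≤ n: for M(n) ≤ 3 and n ≥ 3 no such set exists, since any three points lie on a line or circle, and for M(n) much larger than n the bound fails because the energy is at most n³. *)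

(* Defs.v *)
From HB Require Import structures.
From mathcomp Require Import all_boot all_order all_algebra finmap.
From mathcomp Require Import all_classical all_reals.

Set Implicit Arguments.
Unset Strict Implicit.
Unset Printing Implicit Defensive.

Import Order.TTheory GRing.Theory Num.Theory.

Local Open Scope classical_set_scope.
Local Open Scope ring_scope.

Section Plane.
Variable R : realType.

Implicit Types (a b p : R * R) (L : set (R * R)) (P : {fset R * R}).

Definition dot a b : R := a.1 * b.1 + a.2 * b.2.

(* The line through the midpoint of a and b orthogonal to b - a; meaningful
   only for a != b (it is the whole plane when a = b). *)
Definition bis a b : set (R * R) :=
  [set p | dot (p - ((a.1 + b.1) / 2, (a.2 + b.2) / 2)) (b - a) = 0].

(* A quadruple (a, b, c, d) is encoded as the nested pair (((a, b), c), d). *)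
Definition bisector_energy P : nat :=
  #|` [fset q in (P `*` P `*` P `*` P)%fset |
        let: (a, b, c, d) := q in
        [&& a != b, c != d & `[< bis a b = bis c d >]]]%fset |.

Definition is_line L : Prop :=
  exists a b c : R, (a, b) <> (0, 0) /\
    L = [set p | a * p.1 + b * p.2 + c = 0].

Definition is_circle L : Prop :=
  exists (o : R * R) (r : R), 0 < r /\
    L = [set p | dot (p - o) (p - o) = r ^+ 2].

Definition points_on P L : nat := #|` [fset p in P | p \in L]%fset |.

End Plane.

(* Main.v *)
Require Import Defs.
From HB Require Import structures.
From mathcomp Require Import all_boot all_order all_algebra finmap.
From mathcomp Require Import all_classical all_reals.
From mathcomp Require Import ring lra zify.

(* The points are arranged in k horizontal rows of 3h < M points: the row at
   height b has h points with abscissae b^2, b^2 + 1, ... and 2h points with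
   abscissae -b^2, -b^2 + 1, ...  For every integer h <= t < 2h the reflection
   in the vertical line x = t/2 maps the h right-hand points of every row into
   the same row, so these h axes alone give energy at least h (k h)^2, which is
   of order M n^2.  The heights are chosen one after the other, each so large
   that the new row misses every circle and every non-horizontal line through
   three earlier points; any such curve then contains at most 2 + 2 points.
   For M = 4 rows consisting of a single point give at most 2 + 1 points on a
   curve, and the trivial quadruples (a, b, a, b) suffice. *)

Import Order.TTheory GRing.Theory Num.Theory.

Local Open Scope classical_set_scope.
Local Open Scope ring_scope.

(** * Witnesses from counts, and conditions that hold eventually *)

Lemma count_gt2 (T : eqType) (a : pred T) (s : seq T) :
  uniq s -> (2 < count a s)%N ->
  exists x y z, [/\ [/\ x \in s, y \in s & z \in s],
                    [/\ x != y, x != z & y != z] & [/\ a x, a y & a z]].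
Proof.
move=> us; rewrite -size_filter.
have := filter_uniq a us.
have := fun x => seq.mem_filter a x s.
case: (seq.filter a s) => [|x [|y [|z l]]] //= memE /and4P[Hx Hy _ _] _.
exists x, y, z.
have [/= xs ys zs] := And3 (memE x) (memE y) (memE z).
rewrite !inE !eqxx ?orbT in xs ys zs.
move/esym/andP: xs => [-> ->]; move/esym/andP: ys => [-> ->].
move/esym/andP: zs => [-> ->].
by move: Hx Hy; rewrite !inE !negb_or => /and3P[-> -> _] /andP[-> _].
Qed.

Section Construction.
Variable R : realType.

(** The maximum of finitely many thresholds works; this lets one large height avoid finitely many
    curves at once. *)
Lemma eventually_all (T : eqType) (s : seq T) (Q : T -> R -> Prop) :
  (forall x, x \in s -> exists B, forall b, B <= b -> Q x b) ->
  exists B, forall b, B <= b -> forall x, x \in s -> Q x b.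
Proof.
elim: s => [|x s IH] H; first by exists 0.
have [B1 H1] := H x (mem_head x s).
have [y ys|B2 H2] := IH; first by apply: H; rewrite inE ys orbT.
exists (Num.max B1 B2) => b; rewrite ge_max => /andP[b1 b2] y.
rewrite inE => /predU1P[->|]; [exact: H1|exact: H2].
Qed.

(** * Circles and non-horizontal lines against high rows *)

(* A non-horizontal line or a circle (possibly empty or a point) as soon as A
   and B are not both 0. *)
Definition gcirc (A B C D : R) : pred (R * R) :=
  fun p => A * (p.1 ^+ 2 + p.2 ^+ 2) + B * p.1 + C * p.2 + D == 0.

(** On a row the equation is a polynomial of degree at most 2 in the abscissa, non-constant because
    A or B is nonzero, so it has at most two roots. *)
Lemma gcirc_row (A B C D b x y z : R) :
  (A != 0) || (B != 0) -> x != y -> x != z -> y != z ->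
  gcirc A B C D (x, b) -> gcirc A B C D (y, b) -> ~~ gcirc A B C D (z, b).
Proof.
rewrite /gcirc /= => AB xy xz yz /eqP Ex /eqP Ey; apply/negP => /eqP Ez.
have E1 : A * (x + y) + B = 0.
  have : (x - y) * (A * (x + y) + B) = 0.
    by rewrite -[RHS](subrr 0) -{1}Ex -Ey; ring.
  by move/eqP; rewrite mulf_eq0 subr_eq0 (negbTE xy) => /eqP.
have E2 : A * (x + z) + B = 0.
  have : (x - z) * (A * (x + z) + B) = 0.
    by rewrite -[RHS](subrr 0) -{1}Ex -Ez; ring.
  by move/eqP; rewrite mulf_eq0 subr_eq0 (negbTE xz) => /eqP.
have : A * (y - z) = 0 by rewrite -[RHS](subrr 0) -{1}E1 -E2; ring.
move/eqP; rewrite mulf_eq0 subr_eq0 (negbTE yz) orbF => /eqP A0.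
by move: AB E1; rewrite A0 eqxx mul0r add0r /= => /negP H /eqP.
Qed.

(* Circles are bounded, and a non-horizontal line meets the row at height b at
   abscissa O(b), which is less than b^2 - K. *)
Lemma gcirc_far (A B C D K : R) : (A != 0) || (B != 0) ->
  exists B0, forall b, B0 <= b ->
    forall x, b ^+ 2 - K <= `|x| -> ~~ gcirc A B C D (x, b).
Proof.
have [->|A0] /= := eqVneq A 0; last first.
  move=> _; pose B' := B / A; pose C' := C / A; pose D' := D / A.
  pose E := B' ^+ 2 / 4 + C' ^+ 2 / 4 - D'.
  exists (`|C'| + `|E| + 1) => b hb x _; apply/negP => /eqP /= H.
  have H' : (x + B' / 2) ^+ 2 + (b + C' / 2) ^+ 2 = E.
    apply: (mulfI A0); apply/eqP; rewrite -subr_eq0 -[X in _ == X]H /E /B' /C' /D'.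
    by apply/eqP; field.
  have zE : `|E| + 1 <= b + C' / 2.
    by have := ler_norm (- C'); rewrite normrN; have := normr_ge0 C'; lra.
  have := ler_norm E; have := normr_ge0 E; have := sqr_ge0 (x + B' / 2).
  by move: zE H'; move: (b + _) (x + _) => z w; nra.
move=> B0; pose s := - C / B; pose t := - D / B.
exists (`|s| + `|t| + `|K| + 1) => b hb x hx; apply/negP => /eqP /= H.
have xE : x = s * b + t.
  apply: (mulfI B0); apply/eqP; rewrite -subr_eq0 -[X in _ == X]H /s /t.
  by apply/eqP; field.
have b0 : 0 <= b.
  by apply: le_trans hb; rewrite !addr_ge0.
have : `|x| <= `|s| * b + `|t|.
  by rewrite xE (le_trans (ler_normD _ _)) // normrM (ger0_norm b0).
have := ler_norm K; have := normr_ge0 s; have := normr_ge0 t.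
have := normr_ge0 K; nra.
Qed.

(** (A, B, C) is orthogonal to (U, u1, u2) and (V, v1, v2), hence parallel to their cross product.
    Vanishing 2 x 2 minors express this without division. *)
Lemma cross_parallel (A B C U V u1 u2 v1 v2 : R) :
  A * U + B * u1 + C * u2 = 0 -> A * V + B * v1 + C * v2 = 0 ->
  [/\ A * (u2 * V - U * v2) = B * (u1 * v2 - u2 * v1),
      A * (U * v1 - u1 * V) = C * (u1 * v2 - u2 * v1)
    & B * (U * v1 - u1 * V) = C * (u2 * V - U * v2)].
Proof.
move=> Eu Ev.
have ext (k l x y : R) : x - y = k * 0 + l * 0 -> x = y by lra.
split.
- by apply: (ext u2 (- v2)); rewrite -{1}Ev -Eu; ring.
- by apply: (ext (- u1) v1); rewrite -{1}Ev -Eu; ring.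
- by apply: (ext U (- V)); rewrite -{1}Ev -Eu; ring.
Qed.

(** The threshold must not depend on A, B, C, D. This is possible because the curve through three
    distinct points is unique up to scaling, so its far bound serves all coefficients. *)
Lemma gcirc_far3 (K : R) (p q r : R * R) : p != q -> p != r -> q != r ->
  exists B0, forall b, B0 <= b -> forall A B C D, (A != 0) || (B != 0) ->
    gcirc A B C D p -> gcirc A B C D q -> gcirc A B C D r ->
    forall x, b ^+ 2 - K <= `|x| -> ~~ gcirc A B C D (x, b).
Proof.
case: p q r => [p1 p2] [q1 q2] [r1 r2] pq pr qr.
pose u1 := q1 - p1; pose u2 := q2 - p2; pose v1 := r1 - p1; pose v2 := r2 - p2.
pose U := u1 ^+ 2 + u2 ^+ 2; pose V := v1 ^+ 2 + v2 ^+ 2.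
(* (N1, N2, N3) is the cross product of (U, u1, u2) and (V, v1, v2), hence the
   coefficient vector, up to scaling, of the curve through p, q, r in
   coordinates centred at p. *)
pose N1 := u1 * v2 - u2 * v1.
pose N2 := u2 * V - U * v2.
pose N3 := U * v1 - u1 * V.
have sumsq0 (y z : R) : y ^+ 2 + z ^+ 2 = 0 -> y = 0 /\ z = 0.
  by move=> /eqP; rewrite paddr_eq0 ?sqr_ge0 // !sqrf_eq0 => /andP[/eqP-> /eqP->].
have U0 : U != 0.
  apply: contraNneq pq => /sumsq0[/eqP + /eqP].
  by rewrite !subr_eq0 => /eqP-> /eqP->.
have V0 : V != 0.
  apply: contraNneq pr => /sumsq0[/eqP + /eqP].
  by rewrite !subr_eq0 => /eqP-> /eqP->.
(* If N2 = N3 = 0 then u/U = v/V: inversion centred at p sends q and r to the same point, whence q =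
   r. *)
have N23 : (N2 != 0) || (N3 != 0).
  rewrite -negb_and; apply: contra qr => /andP[/eqP N20 /eqP N30].
  have UV : U = V.
    have : U * V * (U - V) = 0.
      have -> : U * V * (U - V) =
          N3 * (U * v1 + V * u1) - N2 * (U * v2 + V * u2).
        by rewrite /N2 /N3 /U /V; ring.
      by rewrite N20 N30 !mul0r subrr.
    by move/eqP; rewrite !mulf_eq0 (negbTE U0) (negbTE V0) subr_eq0 => /eqP.
  have /eqP : U * (u2 - v2) = 0 by rewrite -N20 /N2 -UV; ring.
  have /eqP : U * (v1 - u1) = 0 by rewrite -N30 /N3 -UV; ring.
  rewrite !mulf_eq0 (negbTE U0) /= /u1 /u2 /v1 /v2 => /eqP E1 /eqP E2.
  by apply/eqP; congr pair; lra.
have par A B C D : gcirc A B C D (p1, p2) -> gcirc A B C D (q1, q2) ->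
    gcirc A B C D (r1, r2) ->
  let B' := B + 2 * A * p1 in let C' := C + 2 * A * p2 in
  [/\ A * N2 = B' * N1, A * N3 = C' * N1 & B' * N3 = C' * N2].
  rewrite /gcirc /= => /eqP Ep /eqP Eq /eqP Er.
  have Eu : A * U + (B + 2 * A * p1) * u1 + (C + 2 * A * p2) * u2 = 0.
    by rewrite -[RHS](subrr 0) -{1}Eq -Ep /U /u1 /u2; ring.
  have Ev : A * V + (B + 2 * A * p1) * v1 + (C + 2 * A * p2) * v2 = 0.
    by rewrite -[RHS](subrr 0) -{1}Er -Ep /V /v1 /v2; ring.
  exact: cross_parallel Eu Ev.
(* When N1 = N2 = 0 the three points lie on a horizontal line, and every curve through them has A =
   B = 0. *)
have [N12|] := boolP ((N1 != 0) || (N2 != 0)); last first.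
  rewrite negb_or !negbK => /andP[/eqP N10 /eqP N20].
  exists 0 => b _ A B C D AB Hp Hq Hr; exfalso.
  have [_ ] := par _ _ _ _ Hp Hq Hr; rewrite N10 N20 !mulr0.
  move: N23; rewrite N20 eqxx /= => N30 /eqP + /eqP.
  rewrite !mulf_eq0 (negbTE N30) !orbF => /eqP A0.
  by move: AB; rewrite A0 eqxx /= mulr0 mul0r addr0 => /negbTE ->.
(* The coefficients expand N1 (X^2 + Y^2) + N2 X + N3 Y with X = x - p1 and Y = y - p2. *)
have [|B1 H1] := gcirc_far N1 (N2 - 2 * N1 * p1) (N3 - 2 * N1 * p2)
  (N1 * (p1 ^+ 2 + p2 ^+ 2) - N2 * p1 - N3 * p2) K.
  have [N10|//] := eqVneq N1 0.
  by move: N12; rewrite N10 eqxx /= mulr0 mul0r subr0.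
exists B1 => b hb A B C D AB Hp Hq Hr x hx.
apply/negP => /eqP /= Hx; move: (H1 b hb x hx) => /negP; apply.
have [E1 E2 E3] := par _ _ _ _ Hp Hq Hr.
move: Hp => /eqP /= Hp.
pose X := x - p1; pose Y := b - p2.
have Kw : A * (X ^+ 2 + Y ^+ 2) + (B + 2 * A * p1) * X + (C + 2 * A * p2) * Y = 0.
  by rewrite -[RHS](subrr 0) -{1}Hx -Hp /X /Y; ring.
(* By proportionality, A and B + 2 A p1 times [w] are multiples of the given equation at (x, b);
   they are not both 0, so [w] vanishes. *)
pose w := N1 * (X ^+ 2 + Y ^+ 2) + N2 * X + N3 * Y.
have Aw : A * w = 0.
  rewrite -[RHS](mulr0 N1) -Kw /w !mulrDr !mulrA E1 E2; ring.
have Bw : (B + 2 * A * p1) * w = 0.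
  rewrite -[RHS](mulr0 N2) -Kw /w !mulrDr !mulrA E3 -E1; ring.
have w0 : w = 0.
  move/eqP: Aw; rewrite mulf_eq0 => /orP[/eqP A0|/eqP //].
  move: AB Bw; rewrite A0 eqxx /= mulr0 mul0r addr0 => B_neq0 /eqP.
  by rewrite mulf_eq0 (negbTE B_neq0) => /eqP.
by rewrite /gcirc /= -w0 /w /X /Y; apply/eqP; ring.
Qed.

(** * Lower bounds for the bisector energy *)

(** Two points of [A] followed by their mirror images in x = t/2 give a quadruple with common
    bisector x = t/2. The first point and its image determine t, so no quadruple is counted
    twice. *)
Lemma energy_lower_bound (P : {fset R * R}) (A : seq (R * R)) (ts : seq R) :
  uniq A -> uniq ts ->
  (forall p t, p \in A -> t \in ts ->
     [/\ p \in P, (t - p.1, p.2) \in P & p.1 != t - p.1]) ->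
  (size ts * (size A * size A) <= bisector_energy P)%N.
Proof.
move=> uA uts H.
pose f (t : R) (z : (R * R) * (R * R)) :=
  (z.1, (t - z.1.1, z.1.2), z.2, (t - z.2.1, z.2.2)).
pose AA := [seq (p, q) | p <- A, q <- A].
have uAA : uniq AA by apply: allpairs_uniq => // -[? ?] [? ?] _ _ [-> ->].
have us : uniq [seq f t z | t <- ts, z <- AA].
  apply: allpairs_uniq => // -[t [[p1 p2] [q1 q2]]] [t' [[p1' p2'] [q1' q2']]] _ _.
  rewrite /f /= => -[<- <- E _ <- <- _ _].
  by move/addIr: E => ->.
rewrite -(size_allpairs pair) -(size_allpairs f).
apply: uniq_leq_size => // z /allpairsP[[t [p q]] /= [tts + ->]].
move=> /allpairsP[[p' q'] /= [pA qA [-> ->]]] {p q}.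
have [Pp Ps np] := H _ _ pA tts; have [Pq Pt nq] := H _ _ qA tts.
have bisE (p : R * R) : p.1 != t - p.1 ->
    bis p (t - p.1, p.2) = [set z | z.1 = t / 2].
  rewrite eq_sym -subr_eq0 => nep; apply/seteqP; split=> -[x y]; rewrite /bis /dot /=.
    rewrite subrr mulr0 addr0 => /eqP.
    rewrite mulf_eq0 (negbTE nep) orbF => /eqP; lra.
  by move=> ->; rewrite subrr mulr0 addr0; field.
rewrite !inE /= Pp Ps Pq Pt /=.
rewrite !bisE //.
have ne (p : R * R) : p.1 != t - p.1 -> p != (t - p.1, p.2).
  by apply: contra_neq => {1}->.
by rewrite !ne //=; apply/asboolP.
Qed.

Lemma energy_ge_pairs (P : {fset R * R}) :
  (#|` P| * #|` P|.-1 <= bisector_energy P)%N.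
Proof.
pose g (p : R * R) (q : R * R) := (p, q, p, q).
pose s := [seq g p q | p <- P, q <- rem p P].
have -> : (#|` P| * #|` P|.-1)%N = size s.
  rewrite size_allpairs_dep sumnE big_map big_seq.
  rewrite (eq_bigr (fun=> #|` P|.-1)) => [|p pP]; last by rewrite size_rem.
  by rewrite -big_seq big_const_seq count_predT iter_addn_0 mulnC.
apply: uniq_leq_size.
  apply: allpairs_uniq_dep => [|p _|[p q] [p' q'] _ _ /= [-> ->]] //.
    exact: fset_uniq.
  exact/rem_uniq/fset_uniq.
move=> z /allpairsPdep[p [q [pP + ->]]].
rewrite (mem_rem_uniq _ (fset_uniq P)) inE /= => /andP[qp qP].
rewrite !inE /= pP qP /= eq_sym qp /=; exact/asboolP.
Qed.

(** * Point sets made of horizontal rows *)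

(** Rows are listed consecutively, so a prefix consists of full rows and at most one truncated
    row. *)
Definition grid (row : R -> seq R) (bs : seq R) : seq (R * R) :=
  [seq (x, b) | b <- bs, x <- row b].

Lemma grid_rcons row bs b :
  grid row (rcons bs b) = grid row bs ++ [seq (x, b) | x <- row b].
Proof. by rewrite /grid map_rcons flatten_rcons. Qed.

Lemma mem_grid row bs p :
  (p \in grid row bs) = (p.2 \in bs) && (p.1 \in row p.2).
Proof.
apply/allpairsPdep/andP => [[b [x [hb hx ->]]]|[h1 h2]] //.
by exists p.2, p.1; rewrite -surjective_pairing.
Qed.

Lemma grid_uniq row bs : uniq bs -> (forall b, b \in bs -> uniq (row b)) ->
  uniq (grid row bs).
Proof.
move=> ub ur; apply: allpairs_uniq_dep => // -[b x] [b' x'] _ _ /= [-> ->] //.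
Qed.

Lemma size_grid row bs s : (forall b, b \in bs -> size (row b) = s) ->
  size (grid row bs) = (size bs * s)%N.
Proof.
elim: bs => //= b bs IH H; rewrite /grid /= size_cat size_map H ?mem_head //.
by rewrite mulSn -IH // => c cb; apply: H; rewrite inE cb orbT.
Qed.

Lemma grid_horizontal row bs s h : uniq bs ->
  (forall b, b \in bs -> size (row b) = s) ->
  (count (fun p => p.2 == h) (grid row bs) <= s)%N.
Proof.
elim: bs => //= b bs IH /andP[bbs ubs] H.
rewrite /grid /= count_cat count_map /=.
have [bh|bh] := eqVneq b h; last first.
  rewrite (eq_count (a2 := pred0)) => [|x]; last by rewrite /= (negbTE bh).
  by rewrite count_pred0 IH // => c cb; apply: H; rewrite inE cb orbT.
rewrite (eq_count (a2 := predT)) => [|x]; last by rewrite /= bh eqxx.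
rewrite count_predT H ?mem_head // -[leqRHS]addn0 leq_add2l leqn0.
rewrite -leqn0 leqNgt -has_count; apply/hasP => -[p].
by rewrite -/(grid row bs) mem_grid => /andP[+ _] /eqP E; rewrite E -bh (negbTE bbs).
Qed.

(** * Greedy choice of the heights *)

Section Rows.
(** [K] is both the least admissible height and the amount by which abscissae may fall short of b^2
    in absolute value. *)
Variables (row : R -> seq R) (s : nat) (K : R).
Hypothesis row_size : forall b, K <= b -> size (row b) = s.
Hypothesis row_uniq : forall b, K <= b -> uniq (row b).
Hypothesis row_far : forall b x, K <= b -> x \in row b -> b ^+ 2 - K <= `|x|.

(** Keeping [s] in the minimum matters for one-point rows, where the total bound 2 + 1 stays below
    4. *)
Lemma count_row A B C D b : K <= b -> (A != 0) || (B != 0) ->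
  (count (gcirc A B C D) [seq (x, b) | x <- row b] <= minn 2 s)%N.
Proof.
move=> Kb AB; rewrite count_map leq_min -[X in _ && (_ <= X)%N](row_size b Kb) count_size andbT.
rewrite leqNgt; apply/negP => /(count_gt2 _ _ _ (row_uniq b Kb)).
case=> x [y [z [_ [xy xz yz] /= [hx hy hz]]]].
by have := gcirc_row _ _ _ _ _ _ _ _ AB xy xz yz hx hy; rewrite hz.
Qed.

(** A curve with more than two points of [S] passes through one of finitely many triples, each of
    which has its own threshold. *)
Lemma next_row (S : seq (R * R)) : uniq S ->
  exists B0, forall b, B0 <= b -> forall A B C D, (A != 0) || (B != 0) ->
    (2 < count (gcirc A B C D) S)%N ->
    forall x, b ^+ 2 - K <= `|x| -> ~~ gcirc A B C D (x, b).
Proof.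
move=> uS.
pose Q p q r b := p != q -> p != r -> q != r ->
  forall A B C D, (A != 0) || (B != 0) ->
    gcirc A B C D p -> gcirc A B C D q -> gcirc A B C D r ->
    forall x, b ^+ 2 - K <= `|x| -> ~~ gcirc A B C D (x, b).
have [|B0 H0] := @eventually_all _ S
    (fun p b => forall q, q \in S -> forall r, r \in S -> Q p q r b).
  move=> p _; apply: eventually_all => q _; apply: eventually_all => r _.
  rewrite /Q.
  have [pq|] := boolP (p != q); last by exists 0.
  have [pr|] := boolP (p != r); last by exists 0.
  have [qr|] := boolP (q != r); last by exists 0.
  have [B0 HB] := gcirc_far3 K p q r pq pr qr.
  by exists B0 => b hb _ _ _; apply: HB.
exists B0 => b hb A B C D AB /(count_gt2 _ _ _ uS).
case=> p [q [r [[pS qS rS] [pq pr qr] [hp hq hr]]]].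
exact: (H0 b hb p pS q qS r rS).
Qed.

(* The row added last misses every curve that already has three points, and
   meets the others at most twice. *)
Lemma rows_exist (k : nat) : exists bs : seq R,
  [/\ size bs = k, uniq bs, forall b, b \in bs -> K <= b
    & forall A B C D, (A != 0) || (B != 0) ->
        (count (gcirc A B C D) (grid row bs) <= 2 + minn 2 s)%N].
Proof.
elim: k => [|k [bs [sz ub Kb cnt]]]; first by exists [::].
have uS : uniq (grid row bs) by apply: grid_uniq => // b /Kb /row_uniq.
have [B0 H0] := next_row _ uS.
have [|B1 H1] := @eventually_all _ bs (fun c b => c < b).
  by move=> c _; exists (c + 1) => b; lra.
pose b := Num.max B0 (Num.max B1 K).
have [b0 b1 b2] : [/\ B0 <= b, B1 <= b & K <= b].
  by split; rewrite /b !le_max lexx ?orbT.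
exists (rcons bs b); split.
- by rewrite size_rcons sz.
- by rewrite rcons_uniq ub andbT; apply/negP => /(H1 b b1); rewrite ltxx.
- by move=> c; rewrite mem_rcons inE => /predU1P[->|/Kb].
move=> A B C D AB; rewrite grid_rcons count_cat.
have [le2|gt2] := leqP (count (gcirc A B C D) (grid row bs)) 2.
  exact: leq_add (count_row _ _ _ _ _ b2 AB).
rewrite [X in (_ + X)%N](_ : _ = 0%N) ?addn0 ?cnt //.
apply/eqP; rewrite -leqn0 leqNgt -has_count; apply/hasP => -[_ /mapP[x xr ->]].
by apply/negP; apply: H0 => //; apply: row_far.
Qed.

(** A horizontal line meets at most one row; all other lines and all circles are instances of
    [gcirc]. The subsequence [T] allows for a truncated last row. *)
Lemma points_on_grid (M : nat) (bs : seq R) (T : seq (R * R)) (L : set (R * R)) :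
  (s < M)%N -> (2 + minn 2 s < M)%N -> uniq bs ->
  (forall b, b \in bs -> K <= b) ->
  (forall A B C D, (A != 0) || (B != 0) ->
        (count (gcirc A B C D) (grid row bs) <= 2 + minn 2 s)%N) ->
  subseq T (grid row bs) -> is_line L \/ is_circle L ->
  (points_on [fset p in T]%fset L < M)%N.
Proof.
move=> sM sM2 ub Kb cnt TG HL.
have uG : uniq (grid row bs) by apply: grid_uniq => // b /Kb /row_uniq.
have bound (a : pred (R * R)) (N : nat) : (forall p, p \in L -> a p) ->
    (count a (grid row bs) <= N)%N -> (N < M)%N ->
    (points_on [fset p in T]%fset L < M)%N.
  move=> La cN NM; apply: leq_ltn_trans NM; apply: leq_trans cN.
  rewrite -size_filter; apply: uniq_leq_size; first exact: fset_uniq.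
  move=> p; rewrite !inE /= seq.mem_filter => /andP[pT /La ->] /=.
  exact: mem_subseq TG _ pT.
case: HL => [[a [b [c [ab LE]]]]|[o [r [r0 LE]]]]; subst L.
  have [a0|a0] := eqVneq a 0; last first.
    apply: (bound (gcirc 0 a b c) _ _ (cnt _ _ _ _ _)) => //; last by rewrite a0 orbT.
    by move=> p; rewrite in_setE /gcirc /= mul0r add0r => /eqP.
  apply: (bound (fun p => p.2 == - c / b) s _ (grid_horizontal _ _ s _ ub _)) => //.
    move=> p; rewrite in_setE /= a0 mul0r add0r => E.
    have b0 : b != 0 by apply/eqP => b0; apply: ab; rewrite a0 b0.
    by apply/eqP; apply: (mulfI b0); rewrite mulrCA divff // mulr1; lra.
  by move=> x /Kb /row_size.
apply: (bound (gcirc 1 (- 2 * o.1) (- 2 * o.2) (o.1 ^+ 2 + o.2 ^+ 2 - r ^+ 2))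
   _ _ (cnt _ _ _ _ _)) => //; last by rewrite oner_eq0.
move=> p; rewrite in_setE /gcirc /dot /= => E; apply/eqP.
rewrite -E; ring.
Qed.

End Rows.

(** * Symmetric rows and their energy *)

Definition sym_row (h : nat) (b : R) : seq R :=
  [seq b ^+ 2 + i%:R | i <- iota 0 h] ++ [seq i%:R - b ^+ 2 | i <- iota 0 h.*2].

Lemma size_sym_row h b : size (sym_row h b) = (3 * h)%N.
Proof. by rewrite size_cat !size_map !size_iota; lia. Qed.

(** The height condition forces b^2 > 2h, so the two blocks lie on opposite sides of 0. *)
Lemma sym_row_uniq h b : h.*2%:R + 1 <= b -> uniq (sym_row h b).
Proof.
move=> hb; rewrite cat_uniq !map_inj_uniq ?iota_uniq ?andbT /=; last 2 first.
- by move=> i j /addIr /eqP; rewrite eqr_nat => /eqP.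
- by move=> i j /addrI /eqP; rewrite eqr_nat => /eqP.
apply/hasP => -[_ /mapP[i + ->] /mapP[j _ E]]; rewrite mem_iota add0n => ih.
have := ler0n R j; have := ler0n R h.*2.
have : i%:R < h.*2%:R :> R by rewrite ltr_nat; lia.
nra.
Qed.

Lemma sym_row_far h b x : h.*2%:R + 1 <= b -> x \in sym_row h b ->
  b ^+ 2 - (h.*2%:R + 1) <= `|x|.
Proof.
move=> hb; have := ler0n R h.*2.
rewrite mem_cat => h0 /orP[] /mapP[i + ->]; rewrite mem_iota add0n => ih.
  by have := ler_norm (b ^+ 2 + i%:R); have := ler0n R i; lra.
have := ler_norm (- (i%:R - b ^+ 2)); rewrite normrN.
have : i%:R < h.*2%:R :> R by rewrite ltr_nat; lia.
lra.
Qed.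

(** The mirror image of b^2 + i in x = t/2 is (t - i) - b^2, and 0 < t - i < 2h whenever i < h <= t
    < 2h. *)
Lemma energy_sym_grid h bs (P : {fset R * R}) : uniq bs ->
  (forall b, b \in bs -> h.*2%:R + 1 <= b) ->
  {subset grid (sym_row h) bs <= P} ->
  (h * (size bs * h) ^ 2 <= bisector_energy P)%N.
Proof.
move=> ub hb sP.
pose A := grid (fun b => [seq b ^+ 2 + i%:R | i <- iota 0 h]) bs.
have uR (m n : nat) (f : R -> R) : injective f ->
    uniq [seq f i%:R | i <- iota m n].
  move=> fi; rewrite map_inj_uniq ?iota_uniq // => i j /fi /eqP.
  by rewrite eqr_nat => /eqP.
have <- : size A = (size bs * h)%N.
  by apply: size_grid => b _; rewrite size_map size_iota.
rewrite -[X in (X * _)%N](size_iota h h) -(size_map (fun t : nat => t%:R : R)) -mulnn.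
apply: energy_lower_bound => [||[p1 p2] t0].
- by apply: grid_uniq => // b _; apply: (uR 0%N h (fun x => b ^+ 2 + x)); apply: addrI.
- exact: (uR h h id).
rewrite mem_grid /= => /[swap] + /andP[bbs /mapP[i ih ->]].
move=> /mapP[t th ->]; have p2b := hb _ bbs.
move: ih th; rewrite !mem_iota add0n => /= ih /andP[ht th].
have th2 : t%:R < h.*2%:R :> R by rewrite ltr_nat; lia.
split.
- apply: sP; rewrite mem_grid bbs mem_cat; apply/orP; left => /=.
  by apply/mapP; exists i; rewrite ?mem_iota.
- apply: sP; rewrite mem_grid bbs mem_cat; apply/orP; right => /=.
  apply/mapP; exists (t - i)%N; first by rewrite mem_iota; lia.
  by rewrite natrB; [ring|lia].
apply/eqP => E; have := ler0n R i; have := ler0n R h.*2.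
nra.
Qed.

(** * The two configurations *)

Lemma card_seq_fset_uniq (T : seq (R * R)) :
  uniq T -> #|` [fset p in T]%fset| = size T.
Proof. by move=> uT; rewrite card_fseq undup_id. Qed.

Lemma general_position (n : nat) : exists P : {fset R * R},
  #|` P| = n /\
  forall L, is_line L \/ is_circle L -> (points_on P L < 4)%N.
Proof.
(* One point per row, all on the parabola x = y^2. *)
pose row (b : R) := [:: b ^+ 2].
have rs (b : R) : 0 <= b -> size (row b) = 1%N by [].
have ru (b : R) : 0 <= b -> uniq (row b) by [].
have rf (b x : R) : 0 <= b -> x \in row b -> b ^+ 2 - 0 <= `|x|.
  by move=> _; rewrite inE subr0 => /eqP ->; apply: ler_norm.
have [bs [sz ub Kb cnt]] := rows_exist row 1 0 rs ru rf n.
exists [fset p in grid row bs]%fset; split.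
  rewrite card_seq_fset_uniq ?(size_grid _ _ 1) ?sz ?muln1 //.
  by apply: grid_uniq => // b /Kb /ru.
move=> L; exact: (points_on_grid row 1 0 rs ru 4 bs).
Qed.

Lemma sym_configuration (h k n M : nat) : (3 * h < M)%N ->
  (4 < M)%N -> (k * (3 * h) <= n)%N -> (n <= k.+1 * (3 * h))%N ->
  exists P : {fset R * R},
    [/\ #|` P| = n,
        forall L, is_line L \/ is_circle L -> (points_on P L < M)%N
      & (h * (k * h) ^ 2 <= bisector_energy P)%N].
Proof.
move=> hM M4 kn nk.
pose row := sym_row h; pose K : R := h.*2%:R + 1.
have rs b : K <= b -> size (row b) = (3 * h)%N by rewrite size_sym_row.
have ru b : K <= b -> uniq (row b) by apply: sym_row_uniq.
have rf b x : K <= b -> x \in row b -> b ^+ 2 - K <= `|x| by apply: sym_row_far.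
have [bs [sz ub Kb cnt]] := rows_exist row _ K rs ru rf k.+1.
have uG : uniq (grid row bs) by apply: grid_uniq => // b /Kb /ru.
have sG : size (grid row bs) = (k.+1 * (3 * h))%N.
  by rewrite (size_grid _ _ (3 * h)) ?sz // => b /Kb /rs.
exists [fset p in take n (grid row bs)]%fset; split.
- by rewrite card_seq_fset_uniq ?take_uniq // size_takel // sG.
- move=> L; apply: (points_on_grid row _ K rs ru M bs) => //; first by lia.
  exact: take_subseq.
(* The last of the k + 1 rows may be truncated; energy is counted only on the k full rows before
   it. *)
case/lastP: bs sz ub Kb {cnt uG sG} => // bs b; rewrite size_rcons => -[sz].
rewrite rcons_uniq => /andP[_ ub] Kb.
have Kb' c : c \in bs -> K <= c by move=> cb; apply: Kb; rewrite mem_rcons inE cb orbT.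
rewrite -sz; apply: energy_sym_grid => // p pG.
rewrite inE /= grid_rcons take_cat (size_grid _ _ (3 * h)) => [|c /Kb' /rs //].
by rewrite sz ltnNge kn /= mem_cat pG.
Qed.

End Construction.

(** * Choice of parameters and the constant *)

Theorem theorem2p2 (R : realType) :
  exists c : R, 0 < c /\
    forall n M : nat, (4 <= M)%N -> (M <= n)%N ->
      exists P : {fset R * R},
        [/\ #|` P| = n,
            forall L : set (R * R),
              is_line L \/ is_circle L -> (points_on P L < M)%N
          & c * (M%:R * n%:R ^+ 2) <= (bisector_energy P)%:R].
Proof.
(* 216 = 6 * 6^2 comes from M <= 6h and n <= 6kh. *)
exists (216%:R^-1); split; first by rewrite invr_gt0 ltr0n.
move=> n M M4 Mn.
suff [P [cP lP eP]] : exists P : {fset R * R},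
    [/\ #|` P| = n,
        forall L, is_line L \/ is_circle L -> (points_on P L < M)%N
      & (M * n ^ 2 <= 216 * bisector_energy P)%N].
  exists P; split=> //; rewrite mulrC ler_pdivrMr ?ltr0n //.
  by rewrite -natrX -!natrM ler_nat [leqRHS]mulnC.
have [M5|] := ltnP 4 M; last first.
  move=> M4'; have {M4 M4'}M4 : M = 4%N by lia.
  have [P [cP lP]] := general_position R n.
  exists P; rewrite M4; split=> //.
  by have := energy_ge_pairs R P; rewrite cP; nia.
(* [h] is the largest integer with 3h < M, positive since M >= 5; [k] is the number of full rows,
   positive since n >= M > 3h. *)
pose h := (M.-1 %/ 3)%N; pose k := (n %/ (3 * h))%N.
have h0 : (0 < h)%N by rewrite /h; lia.
have hM : (3 * h < M)%N by rewrite /h; lia.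
have Mh : (M <= 6 * h)%N by rewrite /h; lia.
have nE := divn_eq n (3 * h).
have rlt : (n %% (3 * h) < 3 * h)%N by rewrite ltn_mod; lia.
rewrite -/k in nE; move: (n %% (3 * h))%N rlt nE => r rlt nE.
have k0 : (0 < k)%N by nia.
have [kn nk] : (k * (3 * h) <= n)%N /\ (n <= k.+1 * (3 * h))%N by split; nia.
have [P [cP lP eP]] := sym_configuration R h k n M hM M5 kn nk.
exists P; split=> //.
have nkh : (n <= 6 * (k * h))%N by nia.
have : (M * n ^ 2 <= (6 * h) * (6 * (k * h)) ^ 2)%N.
  by rewrite leq_mul // leq_exp2r.
by lia.
Qed.
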